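(* Let $X$ be a smooth closed oriented Riemannian spin $4$-manifold with $Spin(4)$-principal bundle $\pi:P\to X$, and let $(M,I_1,I_2,I_3)$ be a hyperKähler manifold with a permuting action of $Sp(1)$. For a map $u\in\mathrm{Map}^{Spin(4)}(P,M)$ denote by $u_*^h$ the restriction of the differential $u_*$ to the horizontal subbundle $\mathcal H\subset TP$ of the Levi-Civita connection, and let $(J_1,J_2,J_3)$ be the natural quaternionic structure on $\mathcal H$. Then the spinor $u$ is harmonic (i.e. $\mathcal D u=0$ for the generalized Dirac operator $\mathcal D$) if and only if $$I_1u_*^hJ_1+I_2u_*^hJ_2+I_3u_*^hJ_3=u_*^h .$$
   Context: HyperKähler: a Riemannian manifold with covariantly constant orthogonal complex structures $I_1,I_2,I_3$ with $I_1I_2=-I_2I_1=I_3$. An isometric $Sp(1)$-action on $M$ is permuting if it preserves $\mathrm{span}(I_1,I_2,I_3)\subset\Gamma(\mathrm{End}(TM))$ and the induced action on it, under the identification $I_1,I_2,I_3\leftrightarrow i,j,k$ with $\mathrm{Im}\,\mathbb H=\mathfrak{sp}(1)$, is the adjoint one. $Spin(4)=Sp_+(1)\times Sp_-(1)$ acts on $\mathbb R^4=\mathbb H$ by $h\mapsto q_-h\bar q_+$, and on $M$ via the projection to $Sp_+(1)$. $W^\pm$ are the representations of $Sp_\pm(1)$ on $\mathbb H$ by left multiplication, with complex structure right multiplication by $i$; $\mathcal W^-$ is the bundle over $X$ associated with $P$ and $W^-$. Clifford multiplication is $\mathbb R^4\otimes W^+\to W^-$, $h_1\otimes h_2\mapsto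 h_1h_2$. (Generalized) spinors are sections of $\mathbb M=P\times_{Spin(4)}M$, identified with the equivariant maps $u\in\mathrm{Map}^{Spin(4)}(P,M)$. The covariant derivative is $\nabla_{\mathrm v}u=u_*(\hat{\mathrm v})$, with $\hat{\mathrm v}$ the horizontal lift of $\mathrm v\in TX$ with respect to the Levi-Civita connection on $P$; it is a section of $T^*X\otimes\pi_!(u^*TM)$, where $\pi_!(u^*TM)\to X$ is the quotient of $u^*TM\to P$ by the group action. Because the action is permuting, $TM\otimes\mathbb C\cong W^+\otimes_{\mathbb C}\tilde E$, where $\tilde E=(TM,I_1)$ as a complex vector bundle (with a modified $Sp(1)$-action); the inclusion $TM\subset TM\otimes\mathbb C\cong W^+\otimes_{\mathbb C}\tilde E$ is $w\mapsto 1\otimes w-j\otimes I_2w$. With $E=\pi_!(u^*\tilde E)$, Clifford multiplication induces a map $Cl:T^*X\otimes\pi_!(u^*TM)\to[\mathcal W^-\otimes E]_r$ onto the real part, which pulled back to $P$ is $h\otimes w\mapsto h\otimes w-(hj)\otimes I_2w$ for $h\in\mathbb H$, $w\in TM$. Here $T^*X\cong TX$ by the metric, and at $p\in P$ over $x$, projecting to the orthonormal frame $(\mathrm v_0,\mathrm v_1,\mathrm v_2,\mathrm v_3)$ of $T_xX$, the vectors $\mathrm v_0,\mathrm v_1,\mathrm v_2,\mathrm v_3$ correspond to $1,i,j,k\in\mathbb H$. The generalized Dirac operator is $\mathcal D u=Cl(\nabla u)$, and $u$ is harmonic if $\mathcal Du=0$. The quaternionic structure $(J_1,J_2,J_3)$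 on $\mathcal H_p$ (with $J_1J_2=-J_2J_1=J_3$, $J_l^2=-\mathrm{id}$) is the unique one such that $\hat{\mathrm v}_l=-J_l\hat{\mathrm v}_0$, $l=1,2,3$, where $\hat{\mathrm v}_0,\dots,\hat{\mathrm v}_3$ are the horizontal lifts to $\mathcal H_p$ of the frame determined by $p$. *)

(* Defs.v *)
From HB Require Import structures.
From mathcomp Require Import all_boot all_order all_algebra.
From mathcomp Require Import all_classical all_reals all_analysis.
From mathcomp Require Import ring.

Set Implicit Arguments.
Unset Strict Implicit.
Unset Printing Implicit Defensive.

Import Order.TTheory GRing.Theory Num.Theory.
Import numFieldNormedType.Exports.

Local Open Scope classical_set_scope.
Local Open Scope ring_scope.

Section Quaternions.
Context {R : realType}.

(** The coordinates of a quaternion are those in the basis 1, i, j, k. *)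
Definition quat : Type := 'rV[R]_4.

Definition mkquat (a b c d : R) : quat :=
  \row_(l < 4) [:: a; b; c; d]`_l.

Definition qunit (l : 'I_4) : quat := delta_mx 0 l.

Definition qone : quat := qunit 0.
Definition qi : quat := qunit 1.
Definition qj : quat := qunit 2.
Definition qk : quat := qunit 3.

Definition qmul (p q : quat) : quat :=
  mkquat
    (p 0 0 * q 0 0 - p 0 1 * q 0 1 - p 0 2 * q 0 2 - p 0 3 * q 0 3)
    (p 0 0 * q 0 1 + p 0 1 * q 0 0 + p 0 2 * q 0 3 - p 0 3 * q 0 2)
    (p 0 0 * q 0 2 - p 0 1 * q 0 3 + p 0 2 * q 0 0 + p 0 3 * q 0 1)
    (p 0 0 * q 0 3 + p 0 1 * q 0 2 - p 0 2 * q 0 1 + p 0 3 * q 0 0).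

Definition qconj (q : quat) : quat :=
  mkquat (q 0 0) (- q 0 1) (- q 0 2) (- q 0 3).

Definition qdot (p q : quat) : R := \sum_(l < 4) p 0 l * q 0 l.

Definition sp1 : set quat := [set q | qdot q q = 1].

(** [(qp, qm)] stands for the element of Sp_+(1) x Sp_-(1). *)
Definition spin4 : set (quat * quat) := [set g | sp1 g.1 /\ sp1 g.2].

Definition spin_one : quat * quat := (qone, qone).

Definition spin_mul (g h : quat * quat) : quat * quat :=
  (qmul g.1 h.1, qmul g.2 h.2).

Definition spin_rot (g : quat * quat) (h : quat) : quat :=
  qmul (qmul g.2 h) (qconj g.1).

Lemma quatP (p q : quat) : p 0 0 = q 0 0 -> p 0 1 = q 0 1 ->
  p 0 2 = q 0 2 -> p 0 3 = q 0 3 -> p = q.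
Proof.
move=> e0 e1 e2 e3; apply/rowP; case=> -[|[|[|[|l]]]] l4 //.
- by rewrite (_ : Ordinal l4 = 0) //; apply: val_inj.
- by rewrite (_ : Ordinal l4 = 1) //; apply: val_inj.
- by rewrite (_ : Ordinal l4 = 2) //; apply: val_inj.
- by rewrite (_ : Ordinal l4 = 3) //; apply: val_inj.
Qed.

Definition qmulr (r q : quat) : quat := qmul q r.

Fact qmulr_linear r : linear (qmulr r).
Proof.
by move=> c p q; apply: quatP; rewrite !mxE /=; ring.
Qed.

HB.instance Definition _ (r : quat) :=
  GRing.isLinear.Build R quat quat _ (qmulr r) (qmulr_linear r).

End Quaternions.

Arguments quat R : clear implicits.

Section Smoothness.
Context {R : realType}.

Fixpoint Ck_at (V W : normedModType R) (k : nat) (f : V -> W) (x : V) : Prop :=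
  if k is k'.+1 then
    (\forall y \near x, differentiable f y) /\
    (forall v : V, Ck_at k' ('D_v f) x)
  else \forall y \near x, {for y, continuous f}.

Definition smooth_at (V W : normedModType R) (f : V -> W) (x : V) : Prop :=
  forall k, Ck_at k f x.

End Smoothness.

Section Manifolds.
Context {R : realType}.

Record chart (T : topologicalType) (n : nat) := Chart {
  chart_dom : set T;
  chart_map :> T -> 'rV[R]_n;
  chart_inv : 'rV[R]_n -> T;
  chart_dom_open : open chart_dom;
  chart_img_open : open (chart_map @` chart_dom);
  chart_mapK : forall x, chart_dom x -> chart_inv (chart_map x) = x;
  chart_map_continuous : forall x, chart_dom x -> {for x, continuous chart_map};
  chart_inv_continuous : forall x, chart_dom x ->
    {for chart_map x, continuous chart_inv}
}.

(** The smooth structure is the one generated by a chosen chart around every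
    point; every smooth structure arises in this way. *)
Record manifold (n : nat) := Manifold {
  carrier :> topologicalType;
  manifold_hausdorff : hausdorff_space carrier;
  manifold_second_countable : @second_countable carrier;
  chart_at : carrier -> chart carrier n;
  chart_at_dom : forall x, chart_dom (chart_at x) x;
  chart_at_smooth : forall x y z,
    chart_dom (chart_at x) z -> chart_dom (chart_at y) z ->
    smooth_at (chart_at y \o chart_inv (chart_at x)) (chart_at x z)
}.

(** A tangent vector at [x] is given by its components in the chosen chart
    around [x]. *)
Definition tangent n (M : manifold n) (x : M) : Type := 'rV[R]_n.

Definition coords_at n (M : manifold n) (x : M) : 'rV[R]_n := chart_at x x.

Definition local_rep m n (N : manifold m) (M : manifold n) (f : N -> M)
    (x : N) : 'rV[R]_m -> 'rV[R]_n :=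
  chart_at (f x) \o f \o chart_inv (chart_at x).

Definition msmooth_at m n (N : manifold m) (M : manifold n) (f : N -> M)
    (x : N) : Prop :=
  {for x, continuous f} /\ smooth_at (local_rep f x) (coords_at x).

Definition msmooth m n (N : manifold m) (M : manifold n) (f : N -> M) : Prop :=
  forall x, msmooth_at f x.

Definition mdiff m n (N : manifold m) (M : manifold n) (f : N -> M) (x : N) :
    'Hom(tangent x, tangent (f x)) :=
  linfun ('d (local_rep f x) (coords_at x)).

(** The components, in the chart around [x], of a tangent vector at [x']. *)
Definition to_coords n (M : manifold n) (x x' : M) :
    'Hom(tangent x', 'rV[R]_n) :=
  linfun ('d (chart_at x \o chart_inv (chart_at x')) (coords_at x')).

(** The tangent vector at the point with coordinates [y] in the chart around
    [x], from its components in that chart. *)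
Definition of_coords n (M : manifold n) (x : M) (y : 'rV[R]_n) :
    'Hom('rV[R]_n, tangent (chart_inv (chart_at x) y)) :=
  linfun ('d (chart_at (chart_inv (chart_at x) y) \o chart_inv (chart_at x)) y).

(** Smoothness of [(q, x) |-> a q x] on the embedded submanifold [S] times [N]:
    in charts, the map has local smooth extensions to the ambient space. *)
Definition smooth_family (V : normedModType R) (S : set V) m n
    (N : manifold m) (M : manifold n) (a : V -> N -> M) : Prop :=
  forall q x, S q ->
    (fun z : V * N => a z.1 z.2) @ within [set z | S z.1] (nbhs (q, x))
      --> a q x /\
    exists F : V * 'rV[R]_m -> 'rV[R]_n,
      smooth_at F (q, coords_at x) /\
      \forall z \near (q, coords_at x), S z.1 ->
        chart_at (a q x) (a z.1 (chart_inv (chart_at x) z.2)) = F z.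

(** Vector fields along [f : N -> M]; those on [M] are the case [f = idfun]. *)
Definition vfield_along m n (N : manifold m) (M : manifold n) (f : N -> M) :=
  forall p : N, tangent (f p).

Definition vfield n (M : manifold n) := vfield_along (@idfun M).

Definition vfield_rep m n (N : manifold m) (M : manifold n) (f : N -> M)
    (Y : vfield_along f) (p : N) (z : 'rV[R]_m) : 'rV[R]_n :=
  to_coords (f p) (f (chart_inv (chart_at p) z))
    (Y (chart_inv (chart_at p) z)).

Definition vfield_smooth_at m n (N : manifold m) (M : manifold n) (f : N -> M)
    (Y : vfield_along f) (p : N) : Prop :=
  smooth_at (vfield_rep Y p) (coords_at p).

End Manifolds.

Arguments manifold R n : clear implicits.

Section Riemannian.
Context {R : realType}.

Section Gram.
Context {n : nat} {M : manifold R n} (g : M -> 'M[R]_n).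

Definition gram_inner (x : M) (v w : tangent x) : R :=
  ((v : 'rV[R]_n) *m g x *m (w : 'rV[R]_n)^T) 0 0.

Arguments gram_inner : clear implicits.

(** The components g_ij in the chart around [x]. *)
Definition gram_coords (x : M) (y : 'rV[R]_n) (i j : 'I_n) : R :=
  gram_inner (chart_inv (chart_at x) y)
    (of_coords x y (delta_mx 0 i)) (of_coords x y (delta_mx 0 j)).

End Gram.

(** [gram x] is the Gram matrix of the metric on [tangent x]. *)
Record riemannian n (M : manifold R n) := Riemannian {
  gram : M -> 'M[R]_n;
  gram_sym : forall x, (gram x)^T = gram x;
  gram_pos : forall x (v : tangent x), v != 0 -> 0 < @gram_inner n M gram x v v;
  gram_smooth : forall x i j,
    smooth_at (fun y => gram_coords gram x y i j) (coords_at x)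
}.

Section LeviCivita.
Context {n : nat} {M : manifold R n} (g : riemannian M).

Definition inner (x : M) (v w : tangent x) : R :=
  @gram_inner n M (gram g) x v w.

Arguments inner : clear implicits.

Definition dgram (x : M) (i j k : 'I_n) : R :=
  'D_(delta_mx 0 i) (fun y => gram_coords (gram g) x y j k) (coords_at x).

(** The Christoffel symbol Gamma^k_ij at [x] in the chart around [x]. *)
Definition christoffel (x : M) (i j k : 'I_n) : R :=
  2^-1 * \sum_(l < n) invmx (gram g x) k l *
    (dgram x i j l + dgram x j i l - dgram x l i j).

(** The Levi-Civita covariant derivative, in the direction [v], of a vector
    field along [f]. *)
Definition nabla m (N : manifold R m) (f : N -> M) (Y : vfield_along f)
    (p : N) (v : tangent p) : tangent (f p) :=
  'D_(v : 'rV[R]_m) (vfield_rep Y p) (coords_at p) +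
  \row_(k < n) \sum_(i < n) \sum_(j < n)
    christoffel (f p) i j k * (mdiff f p v : 'rV[R]_n) 0 i *
    (Y p : 'rV[R]_n) 0 j.

Arguments nabla {m N f} Y p v.

Definition apply_field (A : forall x : M, 'End(tangent x)) (Y : vfield M) :
    vfield M := fun x => A x (Y x).

Definition covariantly_constant (A : forall x : M, 'End(tangent x)) : Prop :=
  forall (Y : vfield M) (x : M), vfield_smooth_at Y x ->
    vfield_smooth_at (apply_field A Y) x /\
    forall v : tangent x, nabla (apply_field A Y) x v = A x (nabla Y x v).

Definition orthogonal_field (A : forall x : M, 'End(tangent x)) : Prop :=
  forall (x : M) (v w : tangent x), inner x (A x v) (A x w) = inner x v w.

End LeviCivita.

(** [orient_sign x] tells whether the coordinate frame at [x] of the chart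
    around [x] is negatively oriented. *)
Record orientation n (M : manifold R n) := Orientation {
  orient_sign : M -> bool;
  orient_continuous : forall x : M, \forall x' \near x,
    0 < (-1) ^+ orient_sign x * (-1) ^+ orient_sign x' *
        \det (\matrix_(i, j) (of_coords x (chart_at x x')
                                (delta_mx 0 i) : 'rV[R]_n) 0 j)
}.

Definition positive_frame n (M : manifold R n) (o : orientation M) (x : M)
    (v : 'I_n -> tangent x) : Prop :=
  0 < (-1) ^+ orient_sign o x * \det (\matrix_(i, j) (v i : 'rV[R]_n) 0 j).

End Riemannian.

Arguments gram_inner {R n M} g x v w.
Arguments inner {R n M} g x v w.
Arguments nabla {R n M} g {m N f} Y p v.
Arguments positive_frame {R n M} o x v.

Section QuaternionicStructures.
Context {R : realType}.

Record quaternionic (V : vectType R) := Quaternionic {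
  cx1 : 'End(V);
  cx2 : 'End(V);
  cx3 : 'End(V);
  cx1_sqr : (cx1 \o cx1 = - \1)%VF;
  cx2_sqr : (cx2 \o cx2 = - \1)%VF;
  cx3_sqr : (cx3 \o cx3 = - \1)%VF;
  cx12 : (cx1 \o cx2 = cx3)%VF;
  cx21 : (cx2 \o cx1 = - cx3)%VF
}.

(** The image of [xi] in Im H under i, j, k |-> I_1, I_2, I_3. *)
Definition cx_of V (I : quaternionic V) (xi : quat R) : 'End(V) :=
  xi 0 1 *: cx1 I + xi 0 2 *: cx2 I + xi 0 3 *: cx3 I.

Record hyperkahler n (M : manifold R n) (g : riemannian M) := HyperKahler {
  hk :> forall x : M, quaternionic (tangent x);
  hk_orth1 : orthogonal_field g (fun x => cx1 (hk x));
  hk_orth2 : orthogonal_field g (fun x => cx2 (hk x));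
  hk_orth3 : orthogonal_field g (fun x => cx3 (hk x));
  hk_const1 : covariantly_constant g (fun x => cx1 (hk x));
  hk_const2 : covariantly_constant g (fun x => cx2 (hk x));
  hk_const3 : covariantly_constant g (fun x => cx3 (hk x))
}.

(** Only the values of [sact] at unit quaternions are meaningful. In
    [sact_permuting], an element q of Sp(1) maps an endomorphism A of TM to
    q_* A q_*^-1, and an element xi of sp(1) to q xi q^-1. *)
Record permuting_action n (M : manifold R n) (g : riemannian M)
    (I : hyperkahler g) := PermutingAction {
  sact :> quat R -> M -> M;
  sact_smooth : smooth_family sp1 sact;
  sact1 : forall x, sact qone x = x;
  sactM : forall q r x, sp1 q -> sp1 r ->
    sact (qmul q r) x = sact q (sact r x);
  sact_isometry : forall q x (v w : tangent x), sp1 q ->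
    inner g (sact q x) (mdiff (sact q) x v) (mdiff (sact q) x w) =
    inner g x v w;
  sact_permuting : forall q x (xi : quat R), sp1 q -> xi 0 0 = 0 ->
    (mdiff (sact q) x \o cx_of (I x) xi =
     cx_of (I (sact q x)) (qmul (qmul q xi) (qconj q)) \o mdiff (sact q) x)%VF
}.

End QuaternionicStructures.

Section SpinStructures.
Context {R : realType}.

(** A principal Spin(4)-bundle over [X] with an equivariant bundle map to the
    bundle of oriented orthonormal frames; [frame p] is the frame determined by
    [p], as an isometry R^4 -> T_x X. As [spin4] has dimension 6, the total
    space has dimension 10; only the values of [pact] on [spin4] are
    meaningful. The equation [frame_equivariant] makes sense because [pact h p]
    and [p] lie over the same point. *)
Record spin_structure (X : manifold R 4) (g : riemannian X)
    (o : orientation X) := SpinStructure {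
  total_space :> manifold R 10;
  bundle_proj : total_space -> X;
  proj_smooth : msmooth bundle_proj;
  pact : quat R * quat R -> total_space -> total_space;
  pact_smooth : smooth_family spin4 pact;
  pact1 : forall p, pact spin_one p = p;
  pactM : forall h k p, spin4 h -> spin4 k ->
    pact (spin_mul h k) p = pact k (pact h p);
  pact_free : forall h p, spin4 h -> pact h p = p -> h = spin_one;
  proj_pact : forall h p, spin4 h -> bundle_proj (pact h p) = bundle_proj p;
  proj_trivial : forall x : X, exists U : set X,
    [/\ open U, U x &
      exists (s : X -> total_space) (t : total_space -> quat R * quat R),
        (forall y, U y -> msmooth_at s y /\ bundle_proj (s y) = y) /\
        (forall p, U (bundle_proj p) ->
          [/\ spin4 (t p),
              smooth_at (t \o chart_inv (chart_at p)) (coords_at p) &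
              p = pact (t p) (s (bundle_proj p))])];
  frame : forall p, 'Hom(quat R, tangent (bundle_proj p));
  frame_smooth : forall l p,
    @vfield_smooth_at _ _ _ _ _ bundle_proj (fun p' => frame p' (qunit l)) p;
  frame_isometry : forall p h k,
    inner g (bundle_proj p) (frame p h) (frame p k) = qdot h k;
  frame_positive : forall p,
    positive_frame o (bundle_proj p) (fun l => frame p (qunit l));
  frame_equivariant : forall h p v, spin4 h ->
    frame (pact h p) v = frame p (spin_rot h v)
}.

Context {X : manifold R 4} {g : riemannian X} {o : orientation X}.
Context (P : spin_structure g o).

(** The frame v_0, ..., v_3 of [T_x X] determined by [p]. *)
Definition frame_field (l : 'I_4) : vfield_along (@bundle_proj X g o P) :=
  fun p => frame p (qunit l).

(** The projection of [TP] to [TX], restricted to a subspace of [T_p P]. *)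
Definition proj_on (p : P) (U : {vspace tangent p}) :
    'Hom(subvs_of U, tangent (bundle_proj p)) :=
  (mdiff (@bundle_proj X g o P) p \o linfun (@vsval _ _ U))%VF.

Definition horizontal_lift (p : P) (U : {vspace tangent p}) :
    'Hom(tangent (bundle_proj p), subvs_of U) := ((proj_on U)^-1)%VF.

(** The principal connection on [P] induced by the Levi-Civita connection of
    [X]: along a horizontal vector, the covariant derivative of the frame
    vanishes. *)
Record levi_civita := LeviCivita {
  hor : forall p : P, {vspace tangent p};
  hor_iso : forall p,
    lker (@proj_on p (hor p)) = 0%VS /\ limg (@proj_on p (hor p)) = fullv;
  hor_smooth : forall Y : vfield X, (forall x, vfield_smooth_at Y x) ->
    forall p, @vfield_smooth_at _ _ _ _ _ (@idfun P)
      (fun p' => vsval (@horizontal_lift p' (hor p') (Y (bundle_proj p')))) p;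
  hor_equivariant : forall h p, spin4 h ->
    ((mdiff (pact h) p @: hor p)%VS = hor (pact h p));
  hor_parallel : forall l p (v : tangent p), v \in hor p ->
    nabla g (frame_field l) p v = 0
}.

Context (H : levi_civita).

Definition hlift (p : P) : 'Hom(tangent (bundle_proj p), subvs_of (hor H p)) :=
  @horizontal_lift p (hor H p).

Definition natural_quaternionic (p : P)
    (J : quaternionic (subvs_of (hor H p))) : Prop :=
  let vhat l := hlift p (frame_field l p) in
  [/\ vhat 1 = - cx1 J (vhat 0),
      vhat 2 = - cx2 J (vhat 0) &
      vhat 3 = - cx3 J (vhat 0)].

Lemma frame_bijective (p : P) :
  lker (frame p) = 0%VS /\ limg (frame p) = fullv.
Proof.
have ker0 : lker (frame p) == 0%VS.
  apply/lker0P/raddf_inj => q Fq0.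
  have : qdot q q = 0.
    by rewrite -(frame_isometry p) Fq0 /inner /gram_inner !mul0mx mxE.
  move/eqP; rewrite psumr_eq0 => [/allP q0|l _]; last exact: sqr_ge0.
  apply/rowP => l; rewrite mxE; apply/eqP.
  by have := q0 l (mem_index_enum l); rewrite -expr2 sqrf_eq0.
split; first exact/eqP.
apply/eqP; rewrite eqEdim subvf /= limg_dim_eq ?dimvf //.
by rewrite (eqP ker0) capv0.
Qed.

Lemma natural_quaternionic_exists (p : P) :
  exists J : quaternionic (subvs_of (hor H p)), natural_quaternionic J.
Proof.
have [/eqP F0 F1] := frame_bijective p.
have [/eqP Q0 Q1] := @hor_iso H p.
pose K : 'Hom(quat R, subvs_of (hor H p)) := (hlift p \o frame p)%VF.
pose K' : 'Hom(subvs_of (hor H p), quat R) :=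
  ((frame p)^-1 \o proj_on (hor H p))%VF.
have KK' v : K (K' v) = v.
  rewrite /K /K' 2!comp_lfunE limg_lfunVK ?F1 ?memvf //.
  by rewrite /hlift /horizontal_lift lker0_lfunK.
have K'K q : K' (K q) = q.
  rewrite /K /K' 2!comp_lfunE /hlift /horizontal_lift.
  by rewrite limg_lfunVK ?Q1 ?memvf // lker0_lfunK.
have KE q : K q = hlift p (frame p q) by rewrite /K comp_lfunE.
clearbody K K'.
pose J l : 'End(subvs_of (hor H p)) :=
  (K \o linfun (qmulr (- qunit l)) \o K')%VF.
have JE l v : J l v = K (qmul (K' v) (- qunit l)).
  by rewrite /J 2!comp_lfunE lfunE.
have JJ i j k (c : R) : (forall q : quat R,
      qmul (qmul q (- qunit j)) (- qunit i) = c *: qmul q (- qunit k)) ->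
    (J i \o J j = c *: J k)%VF.
  move=> qq; apply/lfunP => v.
  by rewrite comp_lfunE scale_lfunE !JE K'K qq linearZ.
have JS l : (forall q : quat R,
      qmul (qmul q (- qunit l)) (- qunit l) = - q) ->
    (J l \o J l = - \1)%VF.
  move=> qq; apply/lfunP => v.
  by rewrite comp_lfunE !JE K'K qq linearN /= KK' opp_lfunE id_lfunE.
have J11 : (J 1 \o J 1 = - \1)%VF.
  by apply: JS => q; apply: quatP; rewrite !mxE /=; ring.
have J22 : (J 2 \o J 2 = - \1)%VF.
  by apply: JS => q; apply: quatP; rewrite !mxE /=; ring.
have J33 : (J 3 \o J 3 = - \1)%VF.
  by apply: JS => q; apply: quatP; rewrite !mxE /=; ring.
have J12 : (J 1 \o J 2 = J 3)%VF.
  rewrite -[RHS]scale1r; apply: JJ => q.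
  by apply: quatP; rewrite !mxE /=; ring.
have J21 : (J 2 \o J 1 = - J 3)%VF.
  rewrite -[RHS]scaleN1r; apply: JJ => q.
  by apply: quatP; rewrite !mxE /=; ring.
have Jvhat l : hlift p (frame_field l p) =
    - J l (hlift p (frame_field 0 p)).
  rewrite /frame_field -!KE JE K'K -linearN /=; congr (K _).
  by apply: quatP; rewrite !mxE /=; ring.
by exists (Quaternionic J11 J22 J33 J12 J21); split; exact: Jvhat.
Qed.

End SpinStructures.

Section Spinors.
Context {R : realType}.

Section TensorProduct.
Context {E : vectType R} (I : 'End(E)).

(** The tensor product over C of [quat], with complex structure right
    multiplication by i, and of [E], with complex structure [I]. As a complex
    vector space the former has the basis 1, j; the pair [(a, b)] stands for
    1 (x) a + j (x) b. *)
Definition tensorC : Type := (E * E)%type.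

Definition pure_tensor (q : quat R) (e : E) : tensorC :=
  (q 0 0 *: e + q 0 1 *: I e, q 0 2 *: e - q 0 3 *: I e).

Lemma pure_tensor_balanced q e : (I \o I = - \1)%VF ->
  pure_tensor (qmul q qi) e = pure_tensor q (I e).
Proof.
move=> I_sqr.
have II v : I (I v) = - v.
  by move/lfunP/(_ v): I_sqr; rewrite comp_lfunE opp_lfunE id_lfunE.
rewrite /pure_tensor /qmul /mkquat /qi /qunit !mxE /= II.
rewrite !(mulr0, mulr1, subr0, add0r, addr0, sub0r) !scaleNr !scalerN !opprK.
by rewrite (addrC (- _)) (addrC (q 0 3 *: e)).
Qed.

Lemma quat_basis (q : quat R) :
  q = q 0 0 *: qone + q 0 1 *: qmul qone qi +
      (q 0 2 *: qj - q 0 3 *: qmul qj qi).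
Proof.
by apply: quatP; rewrite !mxE /=; ring.
Qed.

Lemma pure_tensor_universal (W : lmodType R) (f : quat R -> E -> W) :
  (forall e, linear (f^~ e)) -> (forall q, linear (f q)) ->
  (forall q e, f (qmul q qi) e = f q (I e)) ->
  (exists g : {linear tensorC -> W}, forall q e, g (pure_tensor q e) = f q e) /\
  (forall g h : {linear tensorC -> W},
     (forall q e, g (pure_tensor q e) = f q e) ->
     (forall q e, h (pure_tensor q e) = f q e) -> g =1 h).
Proof.
move=> fl fr fI; split.
  pose g (t : tensorC) : W := f qone t.1 + f qj t.2.
  have g_lin : linear g.
    move=> c s t; rewrite /g /= !fr scalerDr -!addrA; congr (_ + _).
    by rewrite addrCA.
  pose G := GRing.isLinear.Build R tensorC W _ g g_lin.
  pose gL : {linear tensorC -> W} := HB.pack g G.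
  have comb (U : lmodType R) (L : U -> W) (L_lin : linear L) b c x y :
      L (b *: x + c *: y) = b *: L x + c *: L y.
    have L0 : L 0 = 0.
      by have := L_lin (-1) 0 0; rewrite scaler0 addr0 scaleN1r addNr.
    by rewrite L_lin -[c *: y]addr0 L_lin L0 addr0.
  exists gL => q e; rewrite /gL /= /g /=.
  rewrite -scaleNr (comb _ _ (fr qone)) (comb _ _ (fr qj)) -!fI.
  rewrite -(comb _ _ (fl e)) -(comb _ _ (fl e)).
  rewrite -[X in X + _]scale1r -[X in _ + X]scale1r -(comb _ _ (fl e)).
  by rewrite !scale1r scaleNr -quat_basis.
move=> g h gf hf [x y].
have -> : (x, y) = pure_tensor qone x + pure_tensor qj y :> tensorC.
  rewrite /pure_tensor /qone /qj /qunit !mxE /=.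
  rewrite !(scale1r, scale0r, addr0, subr0).
  by rewrite -[RHS]/(x + 0, 0 + y) addr0 add0r.
by rewrite !linearD !gf !hf.
Qed.

End TensorProduct.

Arguments tensorC E : clear implicits.

Context {X : manifold R 4} {gX : riemannian X} {oX : orientation X}.
Context {P : spin_structure gX oX} (H : levi_civita P).
Context {n : nat} {M : manifold R n} {gM : riemannian M}.
Context {I : hyperkahler gM} (a : permuting_action I).

(** [Spin(4)] acts on [M] through its projection to Sp_+(1); the inverse of a
    unit quaternion is its conjugate. *)
Record spinor := Spinor {
  spinor_fun :> P -> M;
  spinor_smooth : msmooth spinor_fun;
  spinor_equivariant : forall h p, spin4 h ->
    spinor_fun (pact h p) = a (qconj h.1) (spinor_fun p)
}.

Context (u : spinor).

Definition hdiff (p : P) : 'Hom(subvs_of (hor H p), tangent (u p)) :=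
  (mdiff u p \o linfun (@vsval _ _ (hor H p)))%VF.

Definition cov_deriv (p : P) : 'Hom(tangent (bundle_proj p), tangent (u p)) :=
  (hdiff p \o hlift H p)%VF.

Definition clifford (x : M) (h : quat R) (w : tangent x) :
    tensorC (tangent x) :=
  pure_tensor (cx1 (I x)) h w -
  pure_tensor (cx1 (I x)) (qmul h qj) (cx2 (I x) w).

(** The pull-back to [P] of the section [D u]. *)
Definition dirac_operator (p : P) : tensorC (tangent (u p)) :=
  \sum_(l < 4) @clifford (u p) (qunit l) (cov_deriv p (frame_field l p)).

Definition harmonic_spinor : Prop := forall p, dirac_operator p = 0.

End Spinors.

Arguments spinor {R X gX oX} P {n M gM I} a.
Arguments tensorC {R} E.

(* Main.v *)
(** Put [w_l = u_* vhat_l] and [D = w_0 + I_1 w_1 + I_2 w_2 + I_3 w_3]. In the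
    complex basis 1, j of the spinor factor, the Dirac operator of [u] is
    [(D, - I_2 D)], so [u] is harmonic iff [D = 0] everywhere. As
    [vhat_l = - J_l vhat_0], the map [F = sum_l I_l u_*^h J_l - u_*^h] satisfies
    [F vhat_0 = - D]. Moreover [F J_l = I_l F], so [D = 0] makes [F] vanish on
    every [vhat_l]; these span the horizontal space. *)

Require Import Defs.
From mathcomp Require Import all_boot all_order all_algebra.
From mathcomp Require Import all_classical all_reals all_analysis.

Local Open Scope classical_set_scope.
Local Open Scope ring_scope.

Import GRing.Theory.

Section QuaternionicAlgebra.
Context {R : realType} {V : vectType R} (I : quaternionic V).

Lemma cx11E v : cx1 I (cx1 I v) = - v.
Proof. by have /lfunP/(_ v) := cx1_sqr I; rewrite comp_lfunE ?opp_lfunE ?id_lfunE. Qed.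

Lemma cx22E v : cx2 I (cx2 I v) = - v.
Proof. by have /lfunP/(_ v) := cx2_sqr I; rewrite comp_lfunE ?opp_lfunE ?id_lfunE. Qed.

Lemma cx33E v : cx3 I (cx3 I v) = - v.
Proof. by have /lfunP/(_ v) := cx3_sqr I; rewrite comp_lfunE ?opp_lfunE ?id_lfunE. Qed.

Lemma cx12E v : cx1 I (cx2 I v) = cx3 I v.
Proof. by have /lfunP/(_ v) := cx12 I; rewrite comp_lfunE ?opp_lfunE ?id_lfunE. Qed.

Lemma cx21E v : cx2 I (cx1 I v) = - cx3 I v.
Proof. by have /lfunP/(_ v) := cx21 I; rewrite comp_lfunE ?opp_lfunE ?id_lfunE. Qed.

Lemma cx13E v : cx1 I (cx3 I v) = - cx2 I v.
Proof. by rewrite -cx12E cx11E. Qed.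

Lemma cx31E v : cx3 I (cx1 I v) = cx2 I v.
Proof. by rewrite -cx12E cx21E linearN /= cx13E opprK. Qed.

Lemma cx32E v : cx3 I (cx2 I v) = - cx1 I v.
Proof. by rewrite -cx12E cx22E linearN. Qed.

Lemma cx23E v : cx2 I (cx3 I v) = cx1 I v.
Proof.
(* The double opposite serves to replace I_3 by - I_2 I_1, after which I_2^2 = -1 applies. *)
by rewrite -cx12E -[cx1 I (cx2 I v)]opprK cx12E -cx21E linearN /= cx22E opprK.
Qed.

Definition cxE :=
  (cx11E, cx22E, cx33E, cx12E, cx21E, cx13E, cx31E, cx32E, cx23E).

End QuaternionicAlgebra.

Section FueterOperator.
Context {R : realType} {V W : vectType R}.
Context (J : quaternionic V) (I : quaternionic W) (f : 'Hom(V, W)).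

(** This is -4 times the projection of [f] onto the maps that intertwine each J_l with I_l: the
    operator f |-> sum_l I_l f J_l has eigenvalues 1 and -3, the latter on exactly those maps. *)
Definition fueter : 'Hom(V, W) :=
  ((cx1 I \o f \o cx1 J) + (cx2 I \o f \o cx2 J) +
   (cx3 I \o f \o cx3 J) - f)%VF.

Lemma fueterE v : fueter v =
  cx1 I (f (cx1 J v)) + cx2 I (f (cx2 J v)) + cx3 I (f (cx3 J v)) - f v.
Proof. by rewrite !add_lfunE opp_lfunE !comp_lfunE. Qed.

(** By the multiplication tables of I and J, both sides expand to the same four signed terms; only
    their order differs. The same holds for J_2 and J_3. *)
Lemma fueter_cx1 v : fueter (cx1 J v) = cx1 I (fueter v).
Proof.
rewrite !fueterE !linearB !linearD /= !cxE !linearN /= ?opprK.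
by rewrite [RHS](ACl (4*3*2*1)).
Qed.

Lemma fueter_cx2 v : fueter (cx2 J v) = cx2 I (fueter v).
Proof.
rewrite !fueterE !linearB !linearD /= !cxE !linearN /= ?opprK.
by rewrite [RHS](ACl (3*4*1*2)).
Qed.

Lemma fueter_cx3 v : fueter (cx3 J v) = cx3 I (fueter v).
Proof.
rewrite !fueterE !linearB !linearD /= !cxE !linearN /= ?opprK.
by rewrite [RHS](ACl (2*1*4*3)).
Qed.

End FueterOperator.

Lemma big_ord4 (V : nmodType) (F : 'I_4 -> V) :
  \sum_(l < 4) F l = F 0 + F 1 + F 2 + F 3.
Proof.
rewrite !big_ord_recl big_ord0 addr0 !addrA.
by congr (F _ + F _ + F _ + F _); apply: val_inj.
Qed.

Lemma forall_ord4 (A : 'I_4 -> Prop) :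
  A 0 -> A 1 -> A 2 -> A 3 -> forall l, A l.
Proof.
by move=> A0 A1 A2 A3 [] [|[|[|[|//]]]] l4;
  [move: A0|move: A1|move: A2|move: A3]; congr A; apply: val_inj.
Qed.

(** The units 1, i, j, k contribute (w_0, - I_2 w_0), (I_1 w_1, I_3 w_1), (I_2 w_2, w_2) and (I_3
    w_3, - I_1 w_3). Each second entry is - I_2 of the first, so the sum vanishes as soon as its
    first entry does. *)
Lemma clifford_sum (R : realType) n (M : manifold R n) (gM : riemannian M)
    (I : hyperkahler gM) (x : M) (w : 'I_4 -> tangent x) (D : tangent x) :
  w 0 + cx1 (I x) (w 1) + cx2 (I x) (w 2) + cx3 (I x) (w 3) = D ->
  \sum_(l < 4) @clifford R n M gM I x (qunit l) (w l) = (D, - cx2 (I x) D).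
Proof.
have pairD (a b c d : tangent x) : (a, b) + (c, d) = (a + c, b + d) by [].
have pairB (a b c d : tangent x) : (a, b) - (c, d) = (a - c, b - d) by [].
move=> <-; rewrite big_ord4 /clifford /pure_tensor !mxE /=.
rewrite !(mulr0, mul0r, mulr1, subr0, sub0r, addr0, oppr0, scale0r, scale1r,
  scaleN1r, add0r).
by rewrite !(pairD, pairB) !linearD /= !cxE !(subr0, sub0r, opprK).
Qed.

Section NaturalStructure.
Context {R : realType} {X : manifold R 4} {g : riemannian X}
  {o : orientation X} {P : spin_structure g o} (H : levi_civita P).

(** The lifts of the frame span the horizontal space, since the projection is injective there and
    the frame spans the tangent space of [X]. *)
Lemma hor_eqP (p : P) (W : vectType R) (f : 'Hom(subvs_of (hor H p), W)) :
  (forall l, f (hlift H p (frame_field l p)) = 0) -> f = 0.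
Proof.
move=> f0; have [_ F1] := frame_bijective p.
have [/eqP Q0 _] := @hor_iso _ _ _ _ _ H p.
apply/lfunP => v; rewrite lfunE /=.
(* [v] is the lift of its own projection [x], which is then expanded in the frame. *)
rewrite -[v](lker0_lfunK Q0).
set x := proj_on _ _.
rewrite -[x](limg_lfunVK (f := frame p)) ?F1 ?memvf //.
rewrite [X in frame p X]row_sum_delta.
rewrite !linear_sum /= big1 // => l _.
by rewrite !linearZ /= f0 scaler0.
Qed.

End NaturalStructure.

Theorem theorem3p7 (R : realType)
    (X : manifold R 4) (gX : riemannian X) (oX : orientation X)
    (X_closed : compact [set: X])
    (P : spin_structure gX oX) (H : levi_civita P)
    (n : nat) (M : manifold R n) (gM : riemannian M) (I : hyperkahler gM)
    (a : permuting_action I)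
    (J : forall p : P, quaternionic (subvs_of (hor H p)))
    (J_natural : forall p : P, natural_quaternionic (J p))
    (u : spinor P a) :
  harmonic_spinor H u <->
  forall p : P,
    ((cx1 (I (u p)) \o hdiff H u p \o cx1 (J p)) +
     (cx2 (I (u p)) \o hdiff H u p \o cx2 (J p)) +
     (cx3 (I (u p)) \o hdiff H u p \o cx3 (J p)))%VF = hdiff H u p.
Proof.
(* The equivalence already holds at each point [p] separately. *)
suff dirac_fueter p : dirac_operator H u p = 0 <->
    fueter (J p) (I (u p)) (hdiff H u p) = 0.
  split=> eq0 p.
    by apply/eqP; rewrite -subr_eq0; apply/eqP/dirac_fueter/eq0.
  apply/dirac_fueter/eqP; rewrite subr_eq0; apply/eqP; exact: eq0.
set F := fueter _ _ _.
pose v l := hlift H p (frame_field l p).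
have [v1 v2 v3] : [/\ v 1 = - cx1 (J p) (v 0), v 2 = - cx2 (J p) (v 0) &
  v 3 = - cx3 (J p) (v 0)] := J_natural p.
have Dv0 : dirac_operator H u p = (- F (v 0), - cx2 (I (u p)) (- F (v 0))).
  have wE l : cov_deriv H u p (frame_field l p) = hdiff H u p (v l).
    exact: comp_lfunE.
  apply: clifford_sum; rewrite !wE v1 v2 v3 !linearN /=.
  by rewrite fueterE opprB !opprD !addrA.
rewrite Dv0; split=> [[/eqP]|->]; last by rewrite lfunE /= oppr0 linear0 oppr0.
rewrite oppr_eq0 => /eqP F0 _; apply: hor_eqP.
by apply: forall_ord4; rewrite -/(v _) ?(v1, v2, v3) ?linearN /= ?fueter_cx1
  ?fueter_cx2 ?fueter_cx3 /= -/F F0 ?linear0 ?oppr0.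
Qed.
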